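(* For every measurable space $(X,\mathcal{A})$ there is a $T$-measurable space $(Y,\mathcal{A}')$ and an onto function $\theta:X\to Y$ such that $\eta:M(Y)\to M(X)$ given by $g\mapsto g\circ\theta$ is an isomorphism (of rings), and the following statements hold. (1) For every $A\in\mathcal{A}$, $\theta(A)\in\mathcal{A}'$. (2) For every $B\in\mathcal{A}'$, $\theta^{-1}(B)\in\mathcal{A}$.
   Context: A measurable space $(X,\mathcal{A})$ is a nonempty set $X$ with a $\sigma$-algebra $\mathcal{A}$ of subsets of $X$. $M(X)$ is the commutative ring (pointwise operations) of all functions $f:X\to\mathbb{R}$ with $f^{-1}(V)\in\mathcal{A}$ for every open $V\subseteq\mathbb{R}$; $M(Y)$ is defined likewise from $(Y,\mathcal{A}')$. A measurable space is $T$-measurable if whenever $x,y$ are distinct points of it, there is a measurable set containing one of them and not the other. *)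

(* Defs.v *)
From HB Require Import structures.
From mathcomp Require Import all_boot all_order all_algebra.
From mathcomp Require Import all_classical all_reals all_analysis.
From mathcomp Require Import measurable_realfun.
Set Implicit Arguments.
Unset Strict Implicit.
Unset Printing Implicit Defensive.
Import Order.TTheory GRing.Theory Num.Theory.
Import numFieldNormedType.Exports.
Local Open Scope classical_set_scope.

Definition T_measurable (d : measure_display) (Y : measurableType d) : Prop :=
  forall x y : Y, x <> y ->
    exists2 A : set Y, measurable A & (A x /\ ~ A y) \/ (A y /\ ~ A x).

(* The library's [{mfun X >-> R}] uses the sigma-algebra on [R] generated by
   half-open intervals; this is the same as testing preimages of open sets. *)
Lemma measurable_fun_openP (R : realType) (d : measure_display)
    (X : measurableType d) (f : X -> R) :
  measurable_fun [set: X] f <->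
  (forall V : set R, open V -> measurable (f @^-1` V)).
Proof.
split=> [mf V oV|mf].
  by rewrite -[_ @^-1` _]setTI; apply: mf => //; exact: open_measurable.
apply: (measurability _ (RGenOpens.measurableE R)) => // _ [_ [a [b ->]] <-].
by rewrite setTI; apply: mf; exact: interval_open.
Qed.

(* Main.v *)
Require Import Defs.
From HB Require Import structures.
From mathcomp Require Import all_boot all_order all_algebra.
From mathcomp Require Import all_classical all_reals all_analysis.
From mathcomp Require Import measurable_realfun.
Import Order.TTheory GRing.Theory Num.Theory.
Import numFieldNormedType.Exports.
Local Open Scope classical_set_scope.

(** Take for [Y] the quotient of [X] by the relation identifying two points
    that no measurable set separates, for [theta] the projection, and for the
    measurable sets of [Y] all sets with measurable preimage.

    A measurable set [A] is a union of equivalence classes, so it equals the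
    preimage of its image ([preimage_proj_image]).  Hence images of measurable
    sets are measurable, and a measurable set separating two points of [X] is
    carried to one separating their classes ([T_measurable_quotient]).

    Composition with [theta] is injective because [theta] is onto.  It is onto
    because a measurable real function [f] is constant on classes: the level
    set of [f] through [x] is measurable, as points of the line are, so it
    contains every point that cannot be separated from [x]
    ([mfun_const_on_classes]).  Hence [f] factors
    as [g \o theta], and [g] is measurable since [Y] carries the final
    sigma-algebra ([measurable_fun_proj]). *)

Section quotient.
Context (d : measure_display) (X : measurableType d).

Definition indistinguishable (x y : X) : bool :=
  `[< forall A : set X, measurable A -> A x <-> A y >].

Lemma indistinguishable_equiv : equiv_class_of indistinguishable.
Proof.
split=> [x|x y|y x z].
- exact/asboolP.
- by apply/asboolP/asboolP => h A mA; rewrite h.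
- by move=> /asboolP xy /asboolP yz; apply/asboolP => A mA; rewrite xy// yz.
Qed.

Canonical indistinguishable_rel := EquivRelPack indistinguishable_equiv.

Definition T_quotient : Type := {eq_quot indistinguishable}%qT.

HB.instance Definition _ := Choice.on T_quotient.

Definition T_proj (x : X) : T_quotient := (\pi_({eq_quot indistinguishable}) x)%qT.

Definition T_repr (y : T_quotient) : X :=
  repr (y : {eq_quot indistinguishable}%qT).

Lemma T_reprK : cancel T_repr T_proj.
Proof. by move=> y; exact: reprK. Qed.

Lemma T_projP (x y : X) : T_proj x = T_proj y <->
  forall A : set X, measurable A -> A x <-> A y.
Proof.
by split=> [/eqmodP/asboolP//|h]; apply/eqmodP/asboolP.
Qed.

HB.instance Definition _ := isPointed.Build T_quotient (T_proj point).

Let measurableQ : set (set T_quotient) :=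
  image_set_system [set: X] T_proj measurable.

Let measurableQE B : measurableQ B = measurable (T_proj @^-1` B).
Proof. by rewrite /measurableQ /image_set_system/= setTI. Qed.

Let measurableQ0 : measurableQ set0.
Proof. by rewrite measurableQE preimage_set0. Qed.

Let measurableQC B : measurableQ B -> measurableQ (~` B).
Proof. by rewrite !measurableQE preimage_setC; exact: measurableC. Qed.

Let measurableQ_bigcup (F : (set T_quotient)^nat) :
  (forall i, measurableQ (F i)) -> measurableQ (\bigcup_i F i).
Proof.
move=> mF; rewrite measurableQE preimage_bigcup.
by apply: bigcup_measurable => i _; rewrite -measurableQE.
Qed.

HB.instance Definition _ := @isMeasurable.Build d T_quotient measurableQ
  measurableQ0 measurableQC measurableQ_bigcup.

Lemma measurable_T_quotientE (B : set T_quotient) :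
  measurable B = measurable (T_proj @^-1` B).
Proof. exact: measurableQE. Qed.

(** Indistinguishable points lie in the same measurable sets, so [A] is a union
    of classes. *)
Lemma preimage_proj_image (A : set X) : measurable A ->
  T_proj @^-1` (T_proj @` A) = A.
Proof.
move=> mA; apply/seteqP; split=> [x [y Ay /T_projP yx]|x Ax]; last by exists x.
exact/(yx A mA).
Qed.

Lemma measurable_proj_image (A : set X) :
  measurable A -> measurable (T_proj @` A).
Proof. by move=> mA; rewrite measurable_T_quotientE preimage_proj_image. Qed.

Lemma range_T_proj : range T_proj = [set: T_quotient].
Proof. by rewrite -subTset => y _; exists (T_repr y) => //; exact: T_reprK. Qed.

(** If no measurable set separates two classes, then none separates their
    representatives: images under [T_proj] of measurable sets of [X] would
    otherwise do so. *)
Lemma T_measurable_quotient : T_measurable T_quotient.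
Proof.
move=> x y xy; apply: contrapT => nsep; apply: xy.
rewrite -(T_reprK x) -(T_reprK y); apply/T_projP => A mA.
have AE z : (T_proj @` A) z <-> A (T_repr z).
  by rewrite -[in A (T_repr z)](preimage_proj_image _ mA)/= T_reprK.
rewrite -!AE; apply: contrapT => nAxy; apply: nsep.
exists (T_proj @` A); first exact: measurable_proj_image.
by case: (pselect ((T_proj @` A) x)); case: (pselect ((T_proj @` A) y)); tauto.
Qed.

(** The universal property of the final sigma-algebra of the projection; both
    directions are used, to pull functions back to [X] and to push them down
    to the quotient. *)
Lemma measurable_fun_proj (d' : measure_display) (Z : measurableType d')
    (g : T_quotient -> Z) :
  measurable_fun [set: X] (g \o T_proj) <-> measurable_fun [set: T_quotient] g.
Proof.
by split=> mg _ B mB; have := mg measurableT B mB;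
  rewrite !setTI measurable_T_quotientE.
Qed.

Section pullback.
Variable R : realType.

(** The level set of [f] through [x] is measurable, so it cannot separate [x]
    from [y]. *)
Lemma mfun_const_on_classes (f : {mfun X >-> R}) (x y : X) :
  T_proj x = T_proj y -> f x = f y.
Proof.
move=> /T_projP xy; have [| + _] := xy (f @^-1` [set f x]).
  exact: measurable_funPTI.
by move=> /(_ erefl).
Qed.

Definition pullback (g : {mfun T_quotient >-> R}) : {mfun X >-> R} :=
  mfun_Sub (mem_set ((measurable_fun_proj _ _ g).2 (measurable_funPT g))).

Lemma pullback_zmod_morphism : zmod_morphism pullback.
Proof. by move=> g h; apply/mfuneqP. Qed.

Lemma pullback_monoid_morphism : monoid_morphism pullback.
Proof. by split=> [|g h]; apply/mfuneqP. Qed.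

HB.instance Definition _ := GRing.isZmodMorphism.Build
  {mfun T_quotient >-> R} {mfun X >-> R} pullback pullback_zmod_morphism.
HB.instance Definition _ := GRing.isMonoidMorphism.Build
  {mfun T_quotient >-> R} {mfun X >-> R} pullback pullback_monoid_morphism.

Lemma factor_proj (f : {mfun X >-> R}) : (f \o T_repr) \o T_proj = f.
Proof. by apply/funext => x; apply: mfun_const_on_classes; exact: T_reprK. Qed.

Lemma measurable_factor (f : {mfun X >-> R}) :
  measurable_fun [set: T_quotient] (f \o T_repr).
Proof. by apply/measurable_fun_proj; rewrite factor_proj. Qed.

Definition pushdown (f : {mfun X >-> R}) : {mfun T_quotient >-> R} :=
  mfun_Sub (mem_set (measurable_factor f)).

Lemma pullback_bij : bijective pullback.
Proof.
exists pushdown => [g|f]; apply/mfuneqP => z /=; first by rewrite T_reprK.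
exact: (congr1 (@^~ z) (factor_proj f)).
Qed.

End pullback.
End quotient.

Theorem proposition17 (R : realType) (d : measure_display)
    (X : measurableType d) :
  exists (d' : measure_display) (Y : measurableType d') (theta : X -> Y)
         (eta : {rmorphism {mfun Y >-> R} -> {mfun X >-> R}}),
    [/\ T_measurable Y /\ range theta = [set: Y],
        forall g : {mfun Y >-> R}, (eta g : X -> R) = (g : Y -> R) \o theta,
        bijective eta,
        forall A : set X, measurable A -> measurable (theta @` A) &
        forall B : set Y, measurable B -> measurable (theta @^-1` B)].
Proof.
exists d, (T_quotient _ X), (T_proj _ X), (pullback _ X R); split=> //.
- by split; [exact: T_measurable_quotient|exact: range_T_proj].
- exact: pullback_bij.
- exact: measurable_proj_image.
- by move=> B; rewrite measurable_T_quotientE.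
Qed.
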